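(* Let $f_1,\dots,f_m\in\mathbb{Z}[x]$ be polynomials with zero constant term, not all zero, and let $R=\mathbb{Z}\langle a\rangle$ be the monogenic ring defined by the relations $f_1(a)=\dots=f_m(a)=0$, i.e. $R\cong x\mathbb{Z}[x]/V$ where $V$ is the ideal of $\mathbb{Z}[x]$ generated by $f_1,\dots,f_m$, with $a$ the image of $x$. Then $R$ is finitely separable if and only if both of the following hold: (i) the greatest common divisor of all coefficients of all the polynomials $f_1,\dots,f_m$ taken together is square-free; (ii) the monic polynomial which is the greatest common divisor of $f_1,\dots,f_m$ in $\mathbb{Q}[x]$ has integer coefficients.
   Context: Rings are associative and not necessarily unital or commutative. A ring $K$ is finitely separable if for every element $a\in K$ and every subring $A\subseteq K$ with $a\notin A$ there exist a finite ring $F$ and a ring homomorphism $\varphi:K\to F$ with $\varphi(a)\notin\varphi(A)$. A positive integer is square-free if it is $1$ or a product of distinct primes. A monogenic ring is a ring generated by a single element. *)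

(* Defs.v *)
From HB Require Import structures.
From mathcomp Require Import all_boot all_order all_algebra.
Set Implicit Arguments. Unset Strict Implicit. Unset Printing Implicit Defensive.
Import Order.TTheory GRing.Theory Num.Theory.
Local Open Scope ring_scope.

Record rng := Rng {
  rcarrier :> zmodType;
  rmul : rcarrier -> rcarrier -> rcarrier;
  rmulA : forall x y z, rmul x (rmul y z) = rmul (rmul x y) z;
  rmulDl : forall x y z, rmul (x + y) z = rmul x z + rmul y z;
  rmulDr : forall x y z, rmul x (y + z) = rmul x y + rmul x z
}.

Definition finite_rng (F : rng) : Prop := exists s : seq F, forall x : F, x \in s.

Definition rng_hom (K F : rng) (phi : K -> F) : Prop :=
  (forall x y, phi (x + y) = phi x + phi y) /\
  (forall x y, phi (rmul x y) = rmul (phi x) (phi y)).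

Definition subrng (K : rng) (A : K -> Prop) : Prop :=
  A 0 /\ (forall x y, A x -> A y -> A (x - y)) /\
  (forall x y, A x -> A y -> A (rmul x y)).

Definition finitely_separable (K : rng) : Prop :=
  forall (a : K) (A : K -> Prop), subrng A -> ~ A a ->
  exists (F : rng) (phi : K -> F),
    finite_rng F /\ rng_hom phi /\ ~ (exists b, A b /\ phi b = phi a).

(* rpow a n = a^(n+1) *)
Definition rpow (K : rng) (a : K) (n : nat) : K := iter n (rmul a) a.

(* evaluation at a of a polynomial p (with zero constant term):
   sum_{i >= 1} p_i a^i ; the constant coefficient is ignored *)
Definition reval (K : rng) (p : {poly int}) (a : K) : K :=
  \sum_(1 <= i < size p) (rpow a i.-1) *~ p`_i.

Definition in_ideal (m : nat) (f : 'I_m -> {poly int}) (p : {poly int}) : Prop :=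
  exists g : 'I_m -> {poly int}, p = \sum_(j < m) g j * f j.

Definition coef_gcd (m : nat) (f : 'I_m -> {poly int}) : nat :=
  \big[gcdn/0%N]_(j < m) \big[gcdn/0%N]_(i < size (f j)) absz ((f j)`_i).

Definition squarefree (n : nat) : Prop :=
  exists s : seq nat, [/\ uniq s, all prime s & n = \prod_(p <- s) p]%N.

Definition monic_gcd (m : nat) (f : 'I_m -> {poly int}) : {poly rat} :=
  let g := \big[@gcdp rat/0]_(j < m) map_poly (intr : int -> rat) (f j) in
  (lead_coef g)^-1 *: g.

Definition int_coefs (q : {poly rat}) : Prop :=
  forall i, exists z : int, q`_i = z%:~R.

(* Main.v *)
Require Import Defs.
From HB Require Import structures.
From mathcomp Require Import all_boot all_order all_algebra.
From mathcomp Require Import boolp zify ring.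
Import Order.TTheory GRing.Theory Num.Theory.
Local Open Scope ring_scope.

(* Write q(a) for the image in K of the polynomial X q, and W for the set of q
   with q(a) = 0; let c be the gcd of the coefficients and G the monic gcd.

   If p^2 divides c, the elements P(a) with P = 0 mod p and with the sum of the
   coefficients of P at the exponents 2^k divisible by p^2 form a subring
   omitting p X(a).  In a finite image two powers of a agree, and they may be
   shifted so that exactly one of the exponents is a power of 2; so p X(a)
   cannot be separated.

   If K is finitely separable, let g = l G be primitive and A the subring of
   the elements congruent modulo G to a polynomial in l X.  Then K/A is
   l-primary torsion, and l^t K is contained in A + l^s K for some t and all
   s >= t; by separability l^t K lies in A.  So the X^k modulo G have bounded
   denominators, two of them agree modulo polynomials of low degree with
   integer coefficients, and G divides a monic integer polynomial.

   Conversely, (i) and (ii) provide a monic w with c w in W, while W lies in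
   c Z[X].  The ideal generated by w is a free module of rank one over (Z/c)[X],
   and K modulo it is a finitely generated group.  Since c is square-free,
   separation inside the ideal reduces to subgroups of F_p[X] stable under
   multiplication by a nonconstant polynomial.  Both that case and the case of
   finitely generated groups follow from one argument on finitely generated
   modules over a domain that is not a field. *)

(** * Separation in finitely generated modules *)

Section Subgroup.
Context {M : zmodType} {H : M -> Prop}.
Context (H0 : H 0) (HB : forall x y, H x -> H y -> H (x - y)).

Lemma subgroupN x : H x -> H (- x).
Proof. by rewrite -sub0r; apply: HB. Qed.

Lemma subgroupD x y : H x -> H y -> H (x + y).
Proof. by move=> Hx Hy; rewrite -[y]opprK; apply/HB/subgroupN. Qed.

Lemma subgroupMz x k : H x -> H (x *~ k).
Proof.
move=> Hx; have Hn (n : nat) : H (x *~ n).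
  elim: n => [|n IH]; first by rewrite mulr0z.
  by rewrite intS mulrzDr mulr1z; apply: subgroupD.
by case: k => n; rewrite ?NegzE ?mulrNz; [|apply: subgroupN]; apply: Hn.
Qed.
End Subgroup.

Lemma subgroup_scale (H : {poly int} -> Prop) :
  H 0 -> (forall x y, H x -> H y -> H (x - y)) ->
  forall k x, H x -> H (k *: x).
Proof.
by move=> H0 HB k x Hx; rewrite -[k]intz scaler_int; apply: subgroupMz.
Qed.

Lemma poly_sum_widen (R : nzRingType) (n : nat) (p : {poly R}) :
  (size p <= n)%N -> p = \sum_(i < n) p`_i *: 'X^i.
Proof.
move=> pn; rewrite -[LHS]coefK poly_def.
rewrite (big_ord_widen n (fun i => p`_i *: 'X^i)) // big_mkcond.
apply: eq_bigr => i _; case: ltnP => // h.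
by rewrite nth_default // scale0r.
Qed.

Definition submodule {P : Type} {M : zmodType} (act : P -> M -> M)
    (H : M -> Prop) : Prop :=
  [/\ H 0, forall x y, H x -> H y -> H (x - y) &
      forall k x, H x -> H (act k x)].

Lemma submoduleD {P : Type} {M : zmodType} (act : P -> M -> M) H :
  submodule act H -> forall x y, H x -> H y -> H (x + y).
Proof.
by case=> H0 HB _; apply: subgroupD.
Qed.

Lemma submodule_sum {P : Type} {M : zmodType} (act : P -> M -> M) H :
  submodule act H ->
  forall n (F : 'I_n -> M), (forall i, H (F i)) -> H (\sum_i F i).
Proof.
move=> HH n F HF; have HD := submoduleD _ _ HH; case: HH => H0 _ _.
by apply: (big_ind H).
Qed.

Section Action.
Context {P : idomainType} {M : zmodType} (act : P -> M -> M).

(** Scalars act through an explicit function instead of a fixed module structure, because F[X] later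
    acts on itself in a twisted way, [k] acting as multiplication by k(r). *)
Definition is_action : Prop :=
  [/\ forall k x y, act k (x - y) = act k x - act k y,
      forall k j x, act (k - j) x = act k x - act j x,
      forall k j x, act (k * j) x = act k (act j x) &
      forall x, act 1 x = x].

Lemma actZ0 : is_action -> forall k, act k 0 = 0.
Proof. by case=> actB _ _ _ k; have := actB k 0 0; rewrite !subrr. Qed.

Lemma actZD : is_action -> forall k x y, act k (x + y) = act k x + act k y.
Proof.
move=> aP k x y; have a0 := actZ0 aP k; case: aP => actB _ _ _.
by rewrite -[y in LHS]opprK actB -[- y]sub0r actB a0 sub0r opprK.
Qed.

Lemma act0Z : is_action -> forall x, act 0 x = 0.
Proof. by case=> _ actB _ _ x; have := actB 0 0 x; rewrite !subrr. Qed.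

Lemma act_sum : is_action ->
  forall n k (F : 'I_n -> M), act k (\sum_i F i) = \sum_i act k (F i).
Proof.
move=> aP n k F; exact: (big_morph (act k) (actZD aP k) (actZ0 aP k)).
Qed.

Lemma add_line_submodule H e : is_action -> submodule act H ->
  submodule act (fun x => exists k, H (x - act k e)).
Proof.
move=> aP HH; have HD := submoduleD _ _ HH; case: HH => H0 HB HZ.
have e0 := act0Z aP e; case: aP => actB Bact Mact _.
split=> [|x y [k Hx] [j Hy]|j x [k Hx]].
- by exists 0; rewrite e0 subr0.
- by exists (k - j); rewrite Bact opprD addrACA -opprD; apply: HB.
- by exists (j * k); rewrite Mact -actB; apply: HZ.
Qed.

(* An e that is not torsion modulo H' is made so by adjoining k' e; this keeps
   b out as soon as k' does not divide the coefficient of e in b, if any. *)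
Lemma torsion_enlargement (t : P) (H : M -> Prop) (es : seq M) (b : M) :
  is_action -> t != 0 -> (forall j, j * t != 1) -> submodule act H -> ~ H b ->
  exists H' : M -> Prop, [/\ submodule act H', forall x, H x -> H' x, ~ H' b &
    forall e, e \in es -> exists2 k, k != 0 & H' (act k e)].
Proof.
move=> aP t0 tU HH Hb; have Mact : forall k j x, act (k * j) x = act k (act j x)
  by case: aP.
elim: es => [|e es [H' [HH' sH Hb' tors]]]; first by exists H; split.
have [H'0 H'B H'Z] := HH'; have H'D := submoduleD _ _ HH'.
have [[k k0 Hke]|ntors] := pselect (exists2 k, k != 0 & H' (act k e)).
  exists H'; split=> // e'; rewrite inE => /orP[/eqP->|]; first by exists k.
  exact: tors.
have [k' k'0 Hk'] : exists2 k', k' != 0 & forall j, ~ H' (b - act j (act k' e)).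
  have [[k Hk]|nk] := pselect (exists k, H' (b - act k e)); last first.
    by exists 1; [exact: oner_neq0|move=> j Hj; apply: nk; exists (j * 1);
      rewrite Mact].
  have k0 : k != 0.
    by apply/eqP => k0; move: Hk; rewrite k0 (act0Z aP) subr0.
  (* If b were in H' + P t k e, then (j t - 1) k e would lie in H'. This coefficient is nonzero
     since t is not invertible, and e has no torsion modulo H'. *)
  exists (t * k) => [|j Hj]; first exact: mulf_neq0.
  have: H' (act (j * (t * k) - k) e).
    have [_ Bact _ _] := aP; rewrite Bact Mact.
    have -> : act j (act (t * k) e) - act k e =
       (b - act k e) - (b - act j (act (t * k) e)).
      by rewrite opprB [RHS]addrC addrA subrK.
    exact: H'B.
  have: j * (t * k) - k != 0.
    rewrite mulrA -{2}[k]mul1r -mulrBl mulf_neq0 // subr_eq0; exact: tU.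
  by move=> n0 Hn; apply: ntors; exists (j * (t * k) - k).
exists (fun x => exists j, H' (x - act j (act k' e))); split.
- exact: add_line_submodule.
- by move=> x Hx; exists 0; rewrite (act0Z aP) subr0; apply: sH.
- by case=> j; apply: Hk'.
- move=> e'; rewrite inE => /orP[/eqP->|/tors[k k0 Hk]].
    by exists k' => //; exists 1; have [_ _ _ ->] := aP; rewrite subrr.
  by exists k => //; exists 0; rewrite (act0Z aP) subr0.
Qed.

(** Modulo the enlarged H' every generator is torsion, so the product k of their annihilators sends
    all of M into H'. As b is outside H', it is outside H + kM. The element t witnesses that P is
    not a field. *)
Lemma separate_scaled (t : P) (H : M -> Prop) (es : seq M) (b : M) :
  is_action -> t != 0 -> (forall j, j * t != 1) -> submodule act H ->
  (forall x, exists k : nat -> P,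
     H (x - \sum_(i < size es) act (k i) es`_i)) ->
  ~ H b -> exists2 k, k != 0 & forall x, ~ H (b - act k x).
Proof.
move=> aP t0 tU HH span Hb.
have [H' [HH' sH Hb' tors]] := torsion_enlargement t H es b aP t0 tU HH Hb.
have [H'0 H'B H'Z] := HH'; have H'D := submoduleD _ _ HH'.
have Mact : forall k j x, act (k * j) x = act k (act j x) by case: aP.
have [k k0 Hk] : exists2 k, k != 0 & forall e, e \in es -> H' (act k e).
  elim: es tors {span} => [|e es IH] tors.
    by exists 1 => //; exact: oner_neq0.
  have [j j0 Hj] := IH (fun e ees => tors e (@mem_behead _ (_ :: es) _ ees)).
  have [i i0 Hi] := tors e (mem_head _ _).
  exists (i * j) => [|e']; first exact: mulf_neq0.
  rewrite inE => /orP[/eqP->|/Hj]; last by rewrite Mact; exact: H'Z.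
  by rewrite mulrC Mact; apply: H'Z.
exists k => // x Hx; apply: Hb'.
rewrite -[b](subrK (act k x)); apply: (H'D); first exact: sH.
have [c Hc] := span x.
rewrite -[x](subrK (\sum_(i < size es) act (c i) es`_i)) (actZD aP).
apply: (H'D); first by apply/H'Z/sH.
rewrite (act_sum aP); apply: submodule_sum HH' _ _ _ => i.
by rewrite -Mact mulrC Mact; apply/H'Z/Hk/mem_nth.
Qed.
End Action.

Section RngTheory.
Context {K : rng}.
Implicit Types x y z : K.

Lemma rmul0l x : rmul 0 x = 0.
Proof. by apply: (addrI (rmul 0 x)); rewrite -rmulDl !addr0. Qed.

Lemma rmul0r x : rmul x 0 = 0.
Proof. by apply: (addrI (rmul x 0)); rewrite -rmulDr !addr0. Qed.

Lemma rmulBl x y z : rmul (x - y) z = rmul x z - rmul y z.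
Proof. by apply: (addIr (rmul y z)); rewrite -rmulDl !subrK. Qed.

Lemma rmulBr x y z : rmul z (x - y) = rmul z x - rmul z y.
Proof. by apply: (addIr (rmul z y)); rewrite -rmulDr !subrK. Qed.
End RngTheory.

(** * Finite quotients and repetitions *)

Definition ideal_of (K : rng) (J : K -> Prop) : Prop :=
  [/\ J 0, forall x y, J x -> J y -> J (x - y) &
      forall x y, J x -> J (rmul x y) /\ J (rmul y x)].

(** The product on the quotient group is computed on representatives; it is well defined because J
    is two-sided. The list [s] meets every class, which makes the quotient finite. *)
Lemma finite_quotient (K : rng) (J : K -> Prop) (s : seq K) :
  ideal_of K J -> (forall x, exists2 y, y \in s & J (x - y)) ->
  exists (F : rng) (phi : K -> F),
    [/\ finite_rng F, rng_hom phi & forall x y, phi x = phi y <-> J (x - y)].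
Proof.
case=> J0 JB JM sP.
pose I : {pred K} := fun x => `[< J x >].
have IZ : zmod_closed I.
  by split=> [|x y /asboolP Jx /asboolP Jy]; apply/asboolP => //; apply: JB.
pose IC : zmodClosed K := HB.pack I (GRing.isZmodClosed.Build K I IZ).
pose Q := @Quotient.quot K IC.
pose pi : K -> Q := \pi_Q%qT.
have piE x y : pi x = pi y <-> J (x - y).
  split=> [/eqP|Jxy]; first by rewrite -Quotient.idealrBE => /asboolP.
  by apply/eqP; rewrite -Quotient.idealrBE; apply/asboolP.
have reprK (u : Q) : pi (repr u) = u by rewrite /pi reprK.
have piD x y : pi (x + y) = pi x + pi y by rewrite /pi raddfD.
pose mul (u v : Q) := pi (rmul (repr u) (repr v)).
have piM x y : pi (rmul x y) = mul (pi x) (pi y).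
  apply/piE; have -> : rmul x y - rmul (repr (pi x)) (repr (pi y)) =
    rmul (x - repr (pi x)) y - rmul (repr (pi x)) (repr (pi y) - y).
    by rewrite rmulBl rmulBr opprB addrA subrK.
  have Jr z : J (z - repr (pi z)) by apply/piE; rewrite reprK.
  have Jr' z : J (repr (pi z) - z) by apply/piE; rewrite reprK.
  by apply: JB; [have [] := JM _ y (Jr x)|have [] := JM _ (repr (pi x)) (Jr' y)].
have mA : associative mul.
  by move=> u v w; rewrite -[u]reprK -[v]reprK -[w]reprK -!piM rmulA.
have mDl u v w : mul (u + v) w = mul u w + mul v w.
  by rewrite -[u]reprK -[v]reprK -[w]reprK -piD -piM rmulDl piD !piM.
have mDr u v w : mul u (v + w) = mul u v + mul u w.
  by rewrite -[u]reprK -[v]reprK -[w]reprK -piD -piM rmulDr piD !piM.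
exists (@Rng Q mul mA mDl mDr), pi; split=> //.
exists (map pi s) => u; have [y ys Jy] := sP (repr u).
by apply/mapP; exists y => //; rewrite -[LHS]reprK; apply/piE.
Qed.

Lemma seq_repeats (T : finType) (u : nat -> T) (m : nat) :
  exists i j : nat, [/\ (m <= i)%N, (i < j)%N & u i = u j].
Proof.
pose v (i : 'I_#|T|.+1) := u (m + i)%N.
have /injectivePn [i [j ij vij]] : ~~ injectiveb v.
  by apply: contraTN isT => /injectiveP/leq_card; rewrite card_ord ltnn.
wlog: i j ij vij / (i < j)%N => [wl|ltij].
  have [/wl|/wl|/val_inj eij] := ltngtP i j; [exact|apply=> //; by rewrite eq_sym|].
  by rewrite eij eqxx in ij.
by exists (m + i)%N, (m + j)%N; rewrite leq_addr ltn_add2l.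
Qed.

Lemma finite_rng_repeats (F : rng) (u : nat -> F) (m : nat) :
  finite_rng F -> exists i j : nat, [/\ (m <= i)%N, (i < j)%N & u i = u j].
Proof.
case=> s sP.
have [i [j [mi ij uij]]] := seq_repeats 'I_(size s).+1 (fun i => inord (index (u i) s)) m.
exists i, j; split=> //.
have := congr1 val uij; rewrite /= !inordK ?ltnS ?index_size // => e.
by rewrite -(nth_index 0 (sP (u i))) e nth_index.
Qed.

(** * Monic polynomials in ideals of Z[X] *)

Lemma map_Fp_eq0 (p : nat) (q : {poly int}) : prime p ->
  (map_poly (intr : int -> 'F_p) q = 0) <-> (forall i, (p%:Z %| q`_i)%Z).
Proof.
move=> pp; have cp : p \in [pchar 'F_p] by exact: pchar_Fp.
split=> [q0 i|dq].
  by rewrite (dvdz_pcharf cp) -coef_map q0 coef0.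
by apply/polyP=> i; rewrite coef0 coef_map /=; apply/eqP; rewrite -(dvdz_pcharf cp).
Qed.

Lemma poly_dvdz_coef (d : int) (q : {poly int}) :
  (forall i, (d %| q`_i)%Z) -> exists q', q = d *: q'.
Proof.
move=> dq; have dzc : (d %| zcontents q)%Z.
  by rewrite dvdz_contents; apply/polyOverP.
have /dvdzP [e ez] := dzc.
by exists (e *: zprimitive q); rewrite scalerA mulrC -ez -zpolyEprim.
Qed.

Lemma lift_Fp_monic (p : nat) (q : {poly 'F_p}) : prime p -> q \is monic ->
  exists2 q', q' \is monic & map_poly (intr : int -> 'F_p) q' = q.
Proof.
move=> pp qm; exists (map_poly (fun z : 'F_p => (z : nat)%:Z) q).
  by rewrite monicE lead_coef_map_id0 // (monicP qm).
rewrite -map_poly_comp_id0 // map_poly_id // => z _ /=.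
by rewrite -pmulrn natr_Zp.
Qed.

Definition poly_ideal (I : {poly int} -> Prop) : Prop :=
  [/\ I 0, forall p q, I p -> I q -> I (p - q) & forall p q, I q -> I (p * q)].

Lemma poly_idealD I : poly_ideal I -> forall p q, I p -> I q -> I (p + q).
Proof.
by case=> I0 IB _; apply: subgroupD.
Qed.

(* For n = n' p: if modulo I the monic h1 is a multiple of n' and the monic h2
   a multiple of p, then h1 h2 is a multiple of n, hence lies in I. *)
Lemma monic_in_poly_ideal (n : nat) (I : {poly int} -> Prop) :
  poly_ideal I -> (0 < n)%N -> I n%:Z%:P ->
  (forall p, prime p -> exists2 q, I q & ~ (forall i, (p%:Z %| q`_i)%Z)) ->
  exists2 h, h \is monic & I h.
Proof.
elim/ltn_ind: n I => n IHn I PI n0 In cI.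
have ID := poly_idealD _ PI; have [I0 IB IM] := PI.
have [n1|n1] := leqP n 1.
  exists 1; first exact: monic1.
  by have -> : 1 = n%:Z%:P :> {poly int} by rewrite (_ : n = 1%N) //; lia.
have pp := pdiv_prime n1; set p := pdiv n in pp *.
have /dvdnP [n' nE] : (p %| n)%N by exact: pdiv_dvd.
(* The induction hypothesis is used for the ideal I + n' Z[X], which contains n'. *)
have [h1 h1m [z1 Ih1]] : exists2 h1, h1 \is monic & exists z, I (h1 - n'%:Z *: z).
  apply: (IHn n').
  - by rewrite nE; have := prime_gt1 pp; nia.
  - split; first by exists 0; rewrite scaler0 subrr.
    + move=> u v [x Hx] [y Hy]; exists (x - y).
      by rewrite scalerBr opprD addrACA -opprD; apply: IB.
    + move=> u v [x Hx]; exists (u * x).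
      by rewrite scalerAr -mulrBr; apply: IM.
  - by move: n0; rewrite nE; case: (n').
  - by exists 1; rewrite -mul_polyC mulr1 subrr.
  - move=> r /cI [q Iq Hq]; exists q => //; exists 0.
    by rewrite scaler0 subr0.
(* Some element of I is nonzero modulo p; over the field ['F_p] it can be made monic, and it is then
   lifted to Z[X]. *)
have [h2 h2m [z2 Ih2]] : exists2 h2, h2 \is monic & exists z, I (h2 - p%:Z *: z).
  have [q Iq nq] := cI p pp.
  pose qb := map_poly (intr : int -> 'F_p) q.
  have qb0 : qb != 0 by apply/eqP => /map_Fp_eq0 H; apply/nq/H.
  have cqm : (lead_coef qb)^-1 *: qb \is monic.
    by rewrite monicE lead_coefZ mulVf // lead_coef_eq0.
  have [h hm hE] := lift_Fp_monic p _ pp cqm.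
  have [u uE] : exists u : int, u%:~R = (lead_coef qb)^-1.
    by exists ((lead_coef qb)^-1 : nat)%:Z; rewrite -pmulrn natr_Zp.
  have /poly_dvdz_coef [z zE] : forall i, (p%:Z %| (h - u *: q)`_i)%Z.
    by apply/map_Fp_eq0 => //; rewrite rmorphB /= hE map_polyZ /= uE subrr.
  exists h => //; exists z; rewrite -zE opprB addrC subrK -mul_polyC; exact: IM.
exists (h1 * h2); first by rewrite monicMl.
have -> : h1 * h2 = h2 * (h1 - n'%:Z *: z1) + (n'%:Z *: z1) * (h2 - p%:Z *: z2)
   + (z1 * z2) * n%:Z%:P.
  by rewrite nE -!mul_polyC PoszM polyCM; ring.
by apply: (ID); [apply: ID|]; apply: IM.
Qed.

(** * Evaluation in a monogenic ring *)

(** Common form of evaluation at [a] and of the functional that sums the coefficients at powers of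
    2, so that linearity is proved once. *)
Definition lincomb {M : zmodType} (u : nat -> M) (q : {poly int}) : M :=
  \sum_(i < size q) u i *~ q`_i.

Lemma lincomb_widen {M : zmodType} (u : nat -> M) (n : nat) (q : {poly int}) :
  (size q <= n)%N -> lincomb u q = \sum_(i < n) u i *~ q`_i.
Proof.
move=> qn; rewrite /lincomb (big_ord_widen n (fun i => u i *~ q`_i)) //.
rewrite big_mkcond; apply: eq_bigr => i _; case: ltnP => // h.
by rewrite nth_default // mulr0z.
Qed.

Lemma lincombB {M : zmodType} (u : nat -> M) p q :
  lincomb u (p - q) = lincomb u p - lincomb u q.
Proof.
pose n := maxn (size p) (size q).
rewrite (@lincomb_widen _ u n (p - q)); last first.
  by rewrite (leq_trans (size_polyD _ _)) // size_polyN.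
rewrite (@lincomb_widen _ u n p) ?leq_maxl // (@lincomb_widen _ u n q) ?leq_maxr //.
by rewrite -sumrB; apply: eq_bigr => i _; rewrite coefB mulrzBr.
Qed.

Lemma lincomb0 {M : zmodType} (u : nat -> M) : lincomb u 0 = 0.
Proof. by rewrite /lincomb size_poly0 big_ord0. Qed.

Lemma lincombD {M : zmodType} (u : nat -> M) p q :
  lincomb u (p + q) = lincomb u p + lincomb u q.
Proof. by rewrite -[q in LHS]opprK lincombB -[- q]sub0r lincombB lincomb0 sub0r opprK. Qed.

Lemma lincombZ {M : zmodType} (u : nat -> M) k q :
  lincomb u (k *: q) = lincomb u q *~ k.
Proof.
rewrite (@lincomb_widen _ u (size q)) ?size_scale_leq // /lincomb mulrz_suml.
by apply: eq_bigr => i _; rewrite coefZ mulrC mulrzA.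
Qed.

Lemma lincombXn {M : zmodType} (u : nat -> M) k : lincomb u 'X^k = u k.
Proof.
rewrite /lincomb size_polyXn big_ord_recr /= big1 ?add0r => [|i _].
  by rewrite coefXn eqxx.
by rewrite coefXn ltn_eqF ?ltn_ord.
Qed.

Lemma lincombC {M : zmodType} (u : nat -> M) (k : int) :
  lincomb u k%:P = u 0%N *~ k.
Proof. by rewrite -alg_polyC -(expr0 'X) lincombZ lincombXn. Qed.

Lemma lincombMX {M : zmodType} (u : nat -> M) q :
  lincomb u (q * 'X) = lincomb (fun i => u i.+1) q.
Proof.
rewrite (@lincomb_widen _ u (size q).+1); last first.
  by have [->|q0] := eqVneq q 0; rewrite ?mul0r ?size_poly0 // size_mulX.
rewrite big_ord_recl coefMX eqxx mulr0z add0r.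
by apply: eq_bigr => i _; rewrite coefMX.
Qed.

(* The value at a of X q: K has no unit, so q itself has no value. *)
Definition ev {K : rng} (a : K) (q : {poly int}) : K := lincomb (rpow a) q.

Lemma reval_mulX (K : rng) (a : K) q : reval ('X * q) a = ev a q.
Proof.
rewrite /reval big_add1 big_mkord /ev (@lincomb_widen _ _ (size ('X * q)).-1).
  by apply: eq_bigr => i _; rewrite coefXM.
by have [->|q0] := eqVneq q 0; rewrite ?size_poly0 // mulrC size_mulX.
Qed.

Section Evaluation.
Context {K : rng}.
Implicit Types x y : K.

Lemma rmulzl x y k : rmul (x *~ k) y = rmul x y *~ k.
Proof.
have rN u : rmul (- u) y = - rmul u y by rewrite -sub0r rmulBl rmul0l sub0r.
have rn (n : nat) : rmul (x *~ n) y = rmul x y *~ n.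
  by elim: n => [|n IH]; rewrite ?mulr0z ?rmul0l // !intS !mulrzDr !mulr1z rmulDl IH.
by case: k => n; rewrite ?NegzE ?mulrNz ?rN rn.
Qed.

Lemma rmulzr x y k : rmul y (x *~ k) = rmul y x *~ k.
Proof.
have rN u : rmul y (- u) = - rmul y u by rewrite -sub0r rmulBr rmul0r sub0r.
have rn (n : nat) : rmul y (x *~ n) = rmul y x *~ n.
  by elim: n => [|n IH]; rewrite ?mulr0z ?rmul0r // !intS !mulrzDr !mulr1z rmulDr IH.
by case: k => n; rewrite ?NegzE ?mulrNz ?rN rn.
Qed.

Lemma evMX (a : K) q : ev a (q * 'X) = rmul a (ev a q).
Proof.
rewrite /ev lincombMX /lincomb (big_morph (rmul a) (rmulDr a) (rmul0r a)).
by apply: eq_bigr => i _; rewrite rmulzr.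
Qed.

(** The extra X appears because (X p)(X q) = X (X p q). *)
Lemma evM (a : K) p q : rmul (ev a p) (ev a q) = ev a ('X * p * q).
Proof.
elim/poly_ind: p => [|p k IH]; first by rewrite mulr0 mul0r /ev lincomb0 rmul0l.
have -> : 'X * (p * 'X + k%:P) * q = ('X * p * q) * 'X + k *: (q * 'X).
  by rewrite -mul_polyC; ring.
rewrite /ev !lincombD lincombZ lincombC -!/(ev _ _) !evMX rmulDl -rmulA IH.
by rewrite rmulzl.
Qed.

Lemma ev_ideal (a : K) p q : ev a p = 0 -> ev a (p * q) = 0.
Proof.
move=> p0; elim/poly_ind: q => [|q k IH]; first by rewrite mulr0 /ev lincomb0.
have -> : p * (q * 'X + k%:P) = (p * q) * 'X + k *: p by rewrite -mul_polyC; ring.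
by rewrite /ev lincombD lincombZ -!/(ev _ _) evMX IH p0 rmul0r mul0rz addr0.
Qed.

End Evaluation.

(** * Sufficiency of the two conditions *)

(** Expansion in base r by repeated division: F[X] is finitely generated as a module over F[r]. *)
Lemma comp_poly_span (F : fieldType) (r q : {poly F}) : (1 < size r)%N ->
  exists k : nat -> {poly F},
    q = \sum_(i < (size r).-1) (k i \Po r) * 'X^i.
Proof.
move=> r1; have r0 : r != 0 by rewrite -size_poly_gt0 ltnW.
have [n] := ubnP (size q); elim: n q => [|n IH] q // ltqn.
have [q0|q0] := eqVneq q 0.
  by exists (fun=> 0); rewrite q0 big1 // => i _; rewrite comp_poly0 mul0r.
have [k kE] : exists k : nat -> {poly F},
    q %/ r = \sum_(i < (size r).-1) (k i \Po r) * 'X^i.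
  apply: IH; rewrite size_divp // (leq_trans _ (ltqn : (size q <= n)%N)) //.
  by rewrite ltn_subrL size_poly_gt0 q0 andbT -subn1 subn_gt0.
(* Substituting r for X turns the factor X into r, which gives quotient times r plus remainder. *)
exists (fun i => k i * 'X + ((q %% r)`_i)%:P).
rewrite [LHS](divp_eq q r) {1}kE mulr_suml.
have remE : q %% r = \sum_(i < (size r).-1) ((q %% r)`_i)%:P * 'X^i.
  rewrite {1}[q %% r](poly_sum_widen _ (size r).-1).
    by apply: eq_bigr => i _; rewrite mul_polyC.
  by rewrite -ltnS (leq_trans (ltn_modpN0 q r0)) // leqSpred.
rewrite {1}remE -big_split; apply: eq_bigr => i _ /=.
by rewrite comp_polyD comp_polyM comp_polyX comp_polyC mulrDl mulrAC.
Qed.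

(** Let X act on F[X] as multiplication by r. Then U is a submodule, the module is finitely
    generated, and X is a nonzero noninvertible scalar, so [separate_scaled] applies. *)
Lemma stable_subgroup_separated (F : fieldType) (r b : {poly F})
    (U : {poly F} -> Prop) :
  (1 < size r)%N -> U 0 -> (forall x y, U x -> U y -> U (x - y)) ->
  (forall c x, U x -> U (c *: x)) -> (forall x, U x -> U (r * x)) -> ~ U b ->
  exists2 k, k != 0 & forall x, ~ U (b - k * x).
Proof.
move=> r1 U0 UB UZ UM Ub.
have UD := subgroupD U0 UB.
pose act (k x : {poly F}) := (k \Po r) * x.
have actP : is_action act.
  split; rewrite /act.
  - by move=> k x y; rewrite mulrBr.
  - by move=> k j x; rewrite comp_polyB mulrBl.
  - by move=> k j x; rewrite comp_polyM mulrA.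
  - by move=> x; rewrite comp_polyC mul1r.
have actU : submodule act U.
  split=> // k x Ux; rewrite /act; elim/poly_ind: k => [|k c IH].
    by rewrite comp_poly0 mul0r.
  rewrite comp_polyD comp_polyM comp_polyX comp_polyC mulrDl mul_polyC.
  by apply: UD; [rewrite mulrAC mulrC; apply: UM|apply: UZ].
have X0 : 'X != 0 :> {poly F} by rewrite polyX_eq0.
have X1 (j : {poly F}) : j * 'X != 1.
  apply/eqP => /(congr1 (coefp 0)) /eqP.
  by rewrite /= coefMX coef1 /= eq_sym oner_eq0.
pose es := [seq 'X^i : {poly F} | i <- iota 0 (size r).-1].
have esi i : (i < (size r).-1)%N -> es`_i = 'X^i.
  by move=> ltir; rewrite (nth_map 0%N) ?size_iota // nth_iota.
have span x : exists k : nat -> {poly F},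
    U (x - \sum_(i < size es) act (k i) es`_i).
  have [k kE] := comp_poly_span F r x r1.
  exists k; rewrite size_map size_iota {1}kE -sumrB big1 // => i _.
  by rewrite esi // subrr.
have [k k0 Hk] := separate_scaled act 'X U es b actP X0 X1 actU span Ub.
by exists (k \Po r) => //; rewrite comp_poly_eq0.
Qed.

(** The order e of s modulo H divides c and exceeds 1. Take a prime p dividing e and c' = c / p: as
    c is square-free, p does not divide c', hence neither does e. *)
Lemma squarefree_order (c : nat) (H : {poly int} -> Prop) (s : {poly int}) :
  (0 < c)%N -> (forall p, prime p -> ~ (p * p %| c)%N) ->
  H 0 -> (forall x y, H x -> H y -> H (x - y)) ->
  H (c%:Z *: s) -> ~ H s ->
  exists p c', [/\ prime p, c = (p * c')%N, ~~ (p %| c')%N & ~ H (c'%:Z *: s)].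
Proof.
move=> c0 sqf H0 HB Hc Hs.
have Hn := subgroup_scale H H0 HB.
pose K n := (0 < n)%N && `[< H (n%:Z *: s) >].
have exK : exists n, K n by exists c; rewrite /K c0; apply/asboolP.
case: (ex_minnP exK) => e /andP[e0 /asboolP He] emin.
have edvd n : H (n%:Z *: s) -> (e %| n)%N.
  move=> Hn'; apply/contraT; rewrite /dvdn -lt0n => m0.
  have : K (n %% e)%N.
    rewrite /K m0; apply/asboolP.
    have -> : ((n %% e)%N%:Z = n%:Z - (n %/ e)%N%:Z * e%:Z)%R.
      by rewrite {2}(divn_eq n e) PoszD PoszM addrC addKr.
    by rewrite scalerBl -scalerA; apply/HB/Hn.
  by move/emin; rewrite leqNgt ltn_mod e0.
have e1 : (1 < e)%N.
  rewrite ltn_neqAle e0 andbT; apply/eqP => e1.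
  by apply: Hs; move: He; rewrite -e1 scale1r.
have pp := pdiv_prime e1; set p := pdiv e in pp.
have pe : (p %| e)%N by exact: pdiv_dvd.
have /dvdnP [c' cE] : (p %| c)%N by exact: dvdn_trans pe (edvd _ Hc).
have npc' : ~~ (p %| c')%N.
  apply/negP => pc'; apply: (sqf p pp).
  by rewrite cE dvdn_mul.
exists p, c'; split; rewrite ?[(p * _)%N]mulnC //.
by move=> /edvd /(dvdn_trans pe); apply/negP.
Qed.

(** Here S stands for the preimage of a subring. Inside the ideal (w), which c annihilates in K, the
    question is brought down to one prime p and then to ['F_p][X]. *)
Lemma separated_mod_monic (K : rng) (a : K) (c : nat) (w : {poly int})
    (S : {poly int} -> Prop) (s : {poly int}) :
  (forall q, ev a q = 0 -> forall i, (c%:Z %| q`_i)%Z) ->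
  w \is monic -> ev a (c%:Z *: w) = 0 -> (0 < c)%N ->
  (forall p, prime p -> ~ (p * p %| c)%N) ->
  (forall q, ev a q = 0 -> S q) ->
  (forall x y, S x -> S y -> S (x - y)) ->
  (forall x y, S x -> S y -> S ('X * x * y)) -> ~ S s ->
  exists2 t, t \is monic & forall z, ~ S (s - t * w * z).
Proof.
move=> cW wm cw c0 sqf S0 SB SM Ss.
have Sz : S 0 by apply: S0; rewrite /ev lincomb0.
have SD := subgroupD Sz SB; have Sn := subgroup_scale S Sz SB.
(* If s is outside S + (w), then t = 1 suffices. Otherwise s is congruent to w q0 modulo S and only
   the ideal (w) matters. *)
have [[q0 Sq0]|nq] := pselect (exists q, S (s - w * q)); last first.
  exists 1; first exact: monic1.
  by move=> z Hz; apply: nq; exists z; rewrite mul1r in Hz.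
have Swq0 : ~ S (w * q0).
  by move=> H; apply: Ss; rewrite -[s](subrK (w * q0)); apply: SD.
suff [t tm Ht] : exists2 t, t \is monic & forall z, ~ S (w * (q0 - t * z)).
  exists t => // z Hz; apply: (Ht z).
  have -> : w * (q0 - t * z) = (s - t * w * z) - (s - w * q0) by ring.
  exact: SB.
have [p [c' [pp cE pc' Sc']]] : exists p c', [/\ prime p, c = (p * c')%N,
    ~~ (p %| c')%N & ~ S (w * (c'%:Z *: q0))].
  apply: (squarefree_order c (fun q => S (w * q))) => //.
  - by rewrite mulr0.
  - by move=> x y Sx Sy; rewrite mulrBr; apply: SB.
  - by apply: S0; rewrite -scalerAr scalerAl; apply: ev_ideal.
(* Since p c' = c and c w vanishes in K, membership in [A2] depends only on q modulo p. *)
pose A2 q := S (w * (c'%:Z *: q)).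
have A2B x y : A2 x -> A2 y -> A2 (x - y).
  by move=> Hx Hy; rewrite /A2 scalerBr mulrBr; apply: SB.
have A2p q : A2 (p%:Z *: q).
  apply: S0; rewrite scalerA -PoszM [(c' * p)%N]mulnC -cE -scalerAr scalerAl.
  exact: ev_ideal.
pose red := map_poly (intr : int -> 'F_p).
have redB x y : red (x - y) = red x - red y by rewrite /red rmorphB.
have redM x y : red (x * y) = red x * red y by rewrite /red rmorphM.
have A2red x y : red x = red y -> A2 x -> A2 y.
  move=> xy Hx; have /poly_dvdz_coef [z zE] : forall i, (p%:Z %| (x - y)`_i)%Z.
    by apply/map_Fp_eq0 => //; rewrite -/(red _) redB xy subrr.
  have -> : y = x - p%:Z *: z by rewrite -zE opprB addrC subrK.
  exact: A2B.
pose U u := exists2 q, A2 q & red q = u.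
have UA q : U (red q) -> A2 q by case=> q' Hq' /A2red; apply.
(* If r in S is nonzero modulo p, then X r is nonconstant modulo p, and multiplication by it
   preserves U because S is closed under the product. *)
have [r r1 Ur] : exists2 r : {poly 'F_p}, (1 < size r)%N & forall x, U x -> U (r * x).
  have [[r Sr r0]|nr] := pselect (exists2 r, S r & red r != 0).
    exists ('X * red r); first by rewrite mulrC size_mulX // ltnS size_poly_gt0.
    move=> _ [q Hq <-]; exists ('X * r * q); last by rewrite !redM /red map_polyX.
    rewrite /A2; have -> : w * (c'%:Z *: ('X * r * q)) = 'X * r * (w * (c'%:Z *: q)).
      by rewrite -!mul_polyC; ring.
    exact: SM.
  (* All of S vanishes modulo p, which forces U = 0. *)
  exists 'X => [|_ [q Hq <-]]; first by rewrite size_polyX.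
  have : red (w * (c'%:Z *: q)) == 0.
    by apply: contrapT => /negP q0'; apply: nr; exists (w * (c'%:Z *: q)).
  rewrite -mul_polyC !redM !mulf_eq0 => /orP[|/orP[]].
  - rewrite -size_poly_eq0 /red size_map_poly_id0 ?(monicP wm) ?oner_eq0 //.
    by rewrite size_poly_eq0 (negPf (monic_neq0 wm)).
  - rewrite /red map_polyC /= polyC_eq0 -(dvdz_pcharf (pchar_Fp pp)) dvdzE /=.
    by rewrite (negPf pc').
  - by move/eqP->; rewrite mulr0; exists 0; rewrite /A2 ?scaler0 ?mulr0 // /red rmorph0.
have UZ k x : U x -> U (k *: x).
  case=> q Hq <-; exists ((k : nat)%:Z *: q).
    by rewrite /A2 scalerA [c'%:Z * _]mulrC -scalerA -scalerAr; apply: Sn.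
  by rewrite /red map_polyZ /= -pmulrn natr_Zp.
have [|||||k k0 Hk] := stable_subgroup_separated _ r (red q0) U r1 => //.
- by exists 0; rewrite /A2 ?scaler0 ?mulr0 // /red rmorph0.
- by move=> _ _ [x Hx <-] [y Hy <-]; exists (x - y); rewrite ?redB //; apply: A2B.
- by move/UA.
have km : (lead_coef k)^-1 *: k \is monic.
  by rewrite monicE lead_coefZ mulVf // lead_coef_eq0.
have [t tm tE] := lift_Fp_monic p _ pp km.
exists t => // z Hz; apply: (Hk ((lead_coef k)^-1 *: red z)).
exists (q0 - t * z); first by rewrite /A2 -scalerAr; apply: Sn.
by rewrite redB redM /red tE -scalerAl -scalerAr.
Qed.

(** First s is separated from S + (v) with v = t w monic. Then Z[X]/(v) is a finitely generated
    group, so [separate_scaled] over the integers, with 2 as noninvertible scalar, gives N with s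
    outside S + (v) + N Z[X]. *)
Lemma separable_of_monic (K : rng) (a : K) (c : nat) (w : {poly int}) :
  (forall y, exists q, y = ev a q) ->
  (forall q, ev a q = 0 -> forall i, (c%:Z %| q`_i)%Z) ->
  w \is monic -> ev a (c%:Z *: w) = 0 -> (0 < c)%N ->
  (forall p, prime p -> ~ (p * p %| c)%N) ->
  finitely_separable K.
Proof.
move=> surj cW wm cw c0 sqf y A [A0 [AB AM]] nAy.
have [s sE] := surj y; pose S q := A (ev a q).
have evB p q : ev a (p - q) = ev a p - ev a q by exact: lincombB.
have SB x z : S x -> S z -> S (x - z) by rewrite /S evB; apply: AB.
have S0 : S 0 by rewrite /S /ev lincomb0.
have [t tm Ht] : exists2 t, t \is monic & forall z, ~ S (s - t * w * z).
  apply: (separated_mod_monic K a c) => //.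
  - by move=> q q0; rewrite /S q0.
  - by move=> p q Sp Sq; rewrite /S -evM; apply: AM.
  - by rewrite /S -sE.
pose v := t * w; have vm : v \is monic by rewrite monicMl.
pose D := (size v).-1.
pose rem q := Pdiv.Ring.rmodp q v.
have divE q : exists z, q = z * v + \sum_(i < D) (rem q)`_i *: 'X^i.
  exists (Pdiv.Ring.rdivp q v); rewrite {1}(Pdiv.RingMonic.rdivp_eq vm q).
  congr (_ + _); apply: poly_sum_widen.
  rewrite -ltnS (leq_trans (Pdiv.Ring.ltn_rmodpN0 q (monic_neq0 vm))) //.
  exact: leqSpred.
pose H q := exists z, S (q - v * z).
pose act (k : int) (q : {poly int}) := k *: q.
have actP : is_action act.
  split; rewrite /act.
  - by move=> k x z; rewrite scalerBr.
  - by move=> k j x; rewrite scalerBl.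
  - by move=> k j x; rewrite scalerA.
  - by move=> x; rewrite scale1r.
have actH : submodule act H.
  split.
  - by exists 0; rewrite mulr0 subrr.
  - move=> p q [x Hx] [z Hz]; exists (x - z).
    by rewrite mulrBr opprD addrACA -opprD; apply: SB.
  - move=> k q [x Hx]; exists (k *: x); rewrite /act -scalerAr -scalerBr.
    exact: subgroup_scale S0 SB _ _ Hx.
have t1 (j : int) : j * 2 != 1 by lia.
pose es := [seq 'X^i : {poly int} | i <- iota 0 D].
have span q : exists k : nat -> int, H (q - \sum_(i < size es) act (k i) es`_i).
  have [z zE] := divE q; exists (fun i => (rem q)`_i), z.
  rewrite size_map size_iota {1}zE.
  have -> : \sum_(i < D) act (rem q)`_i es`_i = \sum_(i < D) (rem q)`_i *: 'X^i.
    apply: eq_bigr => i _.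
    by rewrite (nth_map 0%N) ?size_iota // nth_iota.
  by rewrite addrK mulrC subrr.
have Hs : ~ H s by case=> z; apply: Ht.
have [N N0 HN] := separate_scaled act 2 H es s actP isT t1 actH span Hs.
(* Division by the monic v bounds the degree and N bounds the coefficients, so J has finite
   index. *)
pose J y := exists q z, y = ev a (v * q + N *: z).
have JI : ideal_of K J.
  split.
  - by exists 0, 0; rewrite mulr0 scaler0 addr0 /ev lincomb0.
  - move=> _ _ [q [z ->]] [q' [z' ->]]; exists (q - q'), (z - z').
    by rewrite -evB; congr ev; rewrite -!mul_polyC; ring.
  - move=> _ y' [q [z ->]]; have [u ->] := surj y'; rewrite !evM.
    by split; exists ('X * u * q), ('X * u * z); congr ev; rewrite -!mul_polyC; ring.
pose reps := [seq ev a (\sum_(i < D) (g i : nat)%:Z *: 'X^i)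
               | g : {ffun 'I_D -> 'I_(absz N)} <- enum {: {ffun 'I_D -> 'I_(absz N)}}].
have N0' : (0 < absz N)%N by rewrite absz_gt0.
have repsP x : exists2 z, z \in reps & J (x - z).
  have [q ->] := surj x.
  have modN (k : int) : (absz (k %% N)%Z < absz N)%N.
    by have := ltz_mod k N0; have := modz_ge0 k N0; lia.
  pose g := [ffun i : 'I_D => Ordinal (modN (rem q)`_i)].
  exists (ev a (\sum_(i < D) (g i : nat)%:Z *: 'X^i)).
    by apply/mapP; exists g; rewrite ?mem_enum.
  have [z zE] := divE q.
  exists z, (\sum_(i < D) ((rem q)`_i %/ N)%Z *: 'X^i).
  rewrite -evB; congr ev; rewrite {1}zE mulrC -addrA; congr (_ + _).
  rewrite -sumrB scaler_sumr; apply: eq_bigr => i _.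
  rewrite ffunE /= gez0_abs ?modz_ge0 // -scalerBl scalerA; congr (_ *: _).
  by rewrite {1}(divz_eq (rem q)`_i N) addrK mulrC.
have [F [phi [Ff hom phiE]]] := finite_quotient K J reps JI repsP.
exists F, phi; split=> //; split=> // -[x [Ax /phiE [q [z E]]]].
apply: (HN (- z)); exists (- q).
have -> : s - act N (- z) - v * - q = s + (v * q + N *: z).
  by rewrite /act -!mul_polyC; ring.
by rewrite /S /ev lincombD -!/(ev _ _) -E -sE addrC subrK.
Qed.

(** * Necessity of the first condition *)

Section Hom.
Context {K F : rng} {phi : K -> F} (hom : rng_hom phi).

Lemma rng_hom0 : phi 0 = 0.
Proof. by case: hom => D _; apply: (addrI (phi 0)); rewrite -D !addr0. Qed.

Lemma rng_homB x y : phi (x - y) = phi x - phi y.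
Proof. by case: hom => D _; apply: (addIr (phi y)); rewrite -D !subrK. Qed.

Lemma rng_homMz x k : phi (x *~ k) = phi x *~ k.
Proof.
have hn (n : nat) : phi (x *~ n) = phi x *~ n.
  elim: n => [|n IH]; rewrite ?mulr0z ?rng_hom0 // !intS !mulrzDr !mulr1z.
  by case: hom => -> _; rewrite IH.
case: k => n; first exact: hn.
by rewrite NegzE !mulrNz -[- (x *~ _)]sub0r rng_homB rng_hom0 sub0r hn.
Qed.
End Hom.

(** For positive n the right side is the largest power of 2 not above n; for n = 0 it is 1, so 0 is
    not counted. *)
Definition pow2 (n : nat) : bool := n == (2 ^ trunc_log 2 n)%N.

Lemma pow2_exp2D (n d : nat) : (d < 2 ^ n)%N -> pow2 (2 ^ n + d) = (d == 0)%N.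
Proof.
move=> dn; rewrite /pow2 (@trunc_log_eq 2 n) //; last first.
  by rewrite leq_addr expnS mul2n -addnn ltn_add2l.
by rewrite -[X in _ == X]addn0 eqn_add2l.
Qed.

Lemma not_separable_of_square (K : rng) (a : K) (p : nat) :
  (1 < p)%N -> (forall q, ev a q = 0 -> forall i, ((p * p)%:Z %| q`_i)%Z) ->
  ~ finitely_separable K.
Proof.
move=> p1 ppW fs.
pose lam := lincomb (fun i => (pow2 i : nat)%:Z).
have lamZ k q : lam (k *: q) = lam q * k by rewrite /lam lincombZ mulrzz.
have lamB x y : lam (x - y) = lam x - lam y by exact: lincombB.
pose A y := exists P, [/\ y = ev a P, forall i, (p%:Z %| P`_i)%Z &
                        ((p * p)%:Z %| lam P)%Z].
have evB x y : ev a (x - y) = ev a x - ev a y by exact: lincombB.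
have evZ k q : ev a (k *: q) = ev a q *~ k by exact: lincombZ.
have As : subrng A.
  split; [|split].
  - exists 0; split; first by rewrite /ev lincomb0.
      by move=> i; rewrite coef0 dvdz0.
    by rewrite /lam lincomb0 dvdz0.
  - move=> _ _ [x [-> x1 x2]] [y [-> y1 y2]]; exists (x - y); split.
    + by rewrite evB.
    + by move=> i; rewrite coefB rpredB.
    + by rewrite lamB rpredB.
  (* Both factors are divisible by p, so the product is divisible by p^2 and the condition on [lam]
     is automatic. *)
  - move=> _ _ [x [-> /poly_dvdz_coef[x' ->] _]] [y [-> /poly_dvdz_coef[y' ->] _]].
    exists ((p * p)%:Z *: ('X * x' * y')); split.
    + by rewrite evM; congr ev; rewrite PoszM -!mul_polyC polyCM; ring.
    + by move=> i; rewrite coefZ PoszM dvdz_mulr ?dvdz_mulr ?dvdzz.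
    + by rewrite lamZ dvdz_mull.
have lamX : lam 'X = 1 by rewrite /lam -(expr1 'X) lincombXn.
(* Polynomials with the same value differ by a multiple of p^2, so the value determines [lam] modulo
   p^2; for p X it is p. *)
have nAb : ~ A (ev a (p%:Z *: 'X)).
  case=> P [E _ dP].
  have /poly_dvdz_coef [z zE] : forall i, ((p * p)%:Z %| (p%:Z *: 'X - P)`_i)%Z.
    by apply: ppW; rewrite evB E subrr.
  have : ((p * p)%:Z %| p%:Z)%Z.
    have := congr1 lam zE; rewrite lamB !lamZ lamX mul1r => /eqP.
    by rewrite subr_eq => /eqP ->; rewrite rpredD ?dvdz_mull.
  by rewrite dvdzE /= => /dvdn_leq; nia.
have [F [phi [Ff [hom]]]] := fs _ A As nAb.
apply.
have [i [j [_ ij eij]]] := finite_rng_repeats F (fun i => phi (ev a 'X^i)) 0 Ff.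
have eijm m : phi (ev a 'X^(i + m)) = phi (ev a 'X^(j + m)).
  elim: m => [|m IH]; first by rewrite !addn0.
  by rewrite !addnS !exprSr !evMX; case: hom => _ HM; rewrite !HM IH.
have jj : (j < 2 ^ j)%N by exact: ltn_expl.
(* The shift takes i to 2^j and j to 2^j + (j - i). As 0 < j - i < 2^j, only the first is a power of
   2. *)
pose m := (2 ^ j - i)%N.
have im : (i + m = 2 ^ j + 0)%N by rewrite /m; lia.
have jm : (j + m = 2 ^ j + (j - i))%N by rewrite /m; lia.
(* Here [lam P] = 1 - (1 - 0) = 0, so p P gives an element of A, while [phi] does not distinguish it
   from p X. *)
pose P := 'X - ('X^(i + m) - 'X^(j + m)) : {poly int}.
exists (ev a (p%:Z *: P)); split.
  exists (p%:Z *: P); split=> //.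
  + by move=> k; rewrite coefZ dvdz_mulr.
  + rewrite lamZ /P !lamB lamX /lam !lincombXn im jm !pow2_exp2D ?expn_gt0 //; last by lia.
    by rewrite eqxx subn_eq0 leqNgt ij /= subr0 subrr mul0r dvdz0.
by rewrite !evZ !(rng_homMz hom) /P !evB !(rng_homB hom) eijm subrr subr0.
Qed.

(** * Necessity of the second condition *)

Lemma finite_rng_exponent (F : rng) : finite_rng F ->
  exists2 e : nat, (0 < e)%N & forall x : F, x *~ e%:Z = 0.
Proof.
move=> Ff; have [s sP] := Ff.
have ex (x : F) : exists2 e : nat, (0 < e)%N & x *~ e%:Z = 0.
  have [i [j [_ ij E]]] := finite_rng_repeats F (fun i => x *~ i%:Z) 0 Ff.
  exists (j - i)%N; first by rewrite subn_gt0.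
  by rewrite -subzn ?(ltnW ij) // mulrzBr E subrr.
suff [e e0 He] : exists2 e : nat, (0 < e)%N & forall x, x \in s -> x *~ e%:Z = 0.
  by exists e => // x; apply/He/sP.
elim: s {sP} => [|x s [e e0 He]]; first by exists 1%N.
have [e' e'0 He'] := ex x; exists (e * e')%N; first by rewrite muln_gt0 e0.
move=> y; rewrite inE PoszM => /orP[/eqP->|/He ye]; last by rewrite mulrzA ye mul0rz.
by rewrite mulrC mulrzA He' mul0rz.
Qed.

Section Dvd.
Context (g : {poly int}).
Let toQ : {poly int} -> {poly rat} := map_poly intr.
Definition Qdvd (p : {poly int}) : Prop := toQ g %| toQ p.

Lemma QdvdB p q : Qdvd p -> Qdvd q -> Qdvd (p - q).
Proof. by rewrite /Qdvd /toQ rmorphB; apply: dvdp_sub. Qed.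

Lemma QdvdD p q : Qdvd p -> Qdvd q -> Qdvd (p + q).
Proof. by rewrite /Qdvd /toQ rmorphD; apply: dvdp_add. Qed.

Lemma QdvdMl p q : Qdvd q -> Qdvd (p * q).
Proof. by rewrite /Qdvd /toQ rmorphM; apply: dvdp_mull. Qed.

Lemma QdvdMr p q : Qdvd p -> Qdvd (p * q).
Proof. by rewrite mulrC; apply: QdvdMl. Qed.

Lemma Qdvd_refl : Qdvd g.
Proof. exact: dvdpp. Qed.

Lemma Qdvd0 : Qdvd 0.
Proof. by rewrite /Qdvd /toQ rmorph0 dvdp0. Qed.

Lemma QdvdZ k p : k != 0 -> Qdvd (k *: p) <-> Qdvd p.
Proof. by move=> k0; rewrite /Qdvd /toQ map_polyZ dvdpZr ?intr_eq0. Qed.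

(** Horner's scheme in l X: multiplying a remainder by l X makes its top coefficient a multiple of
    l, so an integer multiple of g cancels it. *)
Lemma reduce_dilated (q : {poly int}) : (1 < size g)%N ->
  exists2 s : {poly int}, (size s <= (size g).-1)%N & Qdvd (q \Po (lead_coef g *: 'X) - s).
Proof.
move=> g1; elim/poly_ind: q => [|q k [s ss Hs]].
  by exists 0; rewrite ?size_poly0 // comp_poly0 subr0; apply: Qdvd0.
set l := lead_coef g in Hs *; pose n := (size g).-1.
pose c := ('X * s)`_n.
exists (l *: ('X * s) - c *: g + k%:P).
  apply/leq_sizeP => j nj; rewrite coefD coefB !coefZ coefC.
  have -> : (j == 0)%N = false by apply/eqP; move: g1 nj; lia.
  move: nj; rewrite leq_eqVlt => /orP[/eqP<-|nj].
    by rewrite -/n -/c /l lead_coefE -/n mulrC subrr add0r.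
  rewrite coefXM; have -> : (j == 0)%N = false by apply/eqP; lia.
  rewrite !nth_default ?mulr0 ?subrr ?addr0 //.
    by rewrite -ltnS in nj; move: nj; rewrite prednK // ltnW.
  by apply: leq_trans ss _; lia.
rewrite comp_polyD comp_polyM comp_polyX comp_polyC.
have -> : (q \Po (l *: 'X)) * (l *: 'X) + k%:P - (l *: ('X * s) - c *: g + k%:P) =
   (l *: 'X) * (q \Po (l *: 'X) - s) + c%:P * g by rewrite -!mul_polyC; ring.
by apply: QdvdD; apply: QdvdMl => //; apply: Qdvd_refl.
Qed.

(** Each term of X p has exponent at most n, so l^n supplies enough factors l. *)
Lemma scaled_is_dilated (l : int) (p : {poly int}) (n : nat) :
  (size p <= n)%N -> exists q, l ^+ n *: ('X * p) = q \Po (l *: 'X).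
Proof.
move=> pn; exists (\sum_(i < n) (l ^+ (n - i.+1) * p`_i) *: 'X^(i.+1)).
rewrite [RHS]raddf_sum /=.
rewrite {1}(poly_sum_widen _ n p pn).
rewrite mulr_sumr scaler_sumr; apply: eq_bigr => i _.
rewrite comp_polyZ comp_Xn_poly exprZn scalerA -scalerAr scalerA -exprS; congr (_ *: _).
by rewrite mulrAC -exprD subnK.
Qed.

End Dvd.

(** The class of X p lies in the subring Z[l x] of Q[X]/(g), with x the class of X and l the leading
    coefficient of g. *)
Definition dilation_related (g p : {poly int}) : Prop :=
  exists q, Qdvd g ('X * p - (q \Po (lead_coef g *: 'X))).

Section DilationRelated.
Context (g : {poly int}).
Let N := dilation_related g.
Let l := lead_coef g.

Lemma dilation_relatedB p q : N p -> N q -> N (p - q).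
Proof.
move=> [u Hu] [v Hv]; exists (u - v).
rewrite comp_polyB; have -> : 'X * (p - q) - ((u \Po (l *: 'X)) - (v \Po (l *: 'X))) =
  ('X * p - (u \Po (l *: 'X))) - ('X * q - (v \Po (l *: 'X))).
  move: (u \Po _) (v \Po _) => x y; ring.
exact: QdvdB.
Qed.

Lemma dilation_relatedZ k p : N p -> N (k *: p).
Proof.
move=> [u Hu]; exists (k *: u).
rewrite comp_polyZ; have -> : 'X * (k *: p) - k *: (u \Po (l *: 'X)) =
  k%:P * ('X * p - (u \Po (l *: 'X))).
  by move: (u \Po _) => x; rewrite -!mul_polyC; ring.
exact: QdvdMl.
Qed.

Lemma dilation_related_Qdvd p : Qdvd g ('X * p) -> N p.
Proof. by move=> Hp; exists 0; rewrite comp_poly0 subr0. Qed.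

Lemma dilation_relatedD p q : N p -> N q -> N (p + q).
Proof.
move=> Np Nq; rewrite -[q]opprK; apply: dilation_relatedB => //.
by rewrite -scaleN1r; apply: dilation_relatedZ.
Qed.

Lemma dilation_related_scaled (p : {poly int}) n : (size p <= n)%N -> N (l ^+ n *: p).
Proof.
move=> pn; have [q qE] := scaled_is_dilated l p n pn; exists q.
by rewrite -scalerAr qE subrr; apply: Qdvd0.
Qed.

Lemma dilation_relatedM p q : N p -> N q -> N ('X * p * q).
Proof.
move=> [u Hu] [v Hv]; exists (u * v); rewrite comp_polyM.
have -> : 'X * ('X * p * q) - (u \Po (l *: 'X)) * (v \Po (l *: 'X)) =
  ('X * p - (u \Po (l *: 'X))) * ('X * q) +
  (u \Po (l *: 'X)) * ('X * q - (v \Po (l *: 'X))).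
  move: (u \Po _) (v \Po _) => x y; ring.
by apply: QdvdD; [apply: QdvdMr|apply: QdvdMl].
Qed.

(* As g is primitive, (g, l) contains a monic h; division by h leaves
   remainders of bounded degree, which a fixed power of l clears. *)
Lemma dilation_related_step : 0 < l -> zcontents g = 1 ->
  exists t, forall k p, exists p', N (l ^+ t *: p - l ^+ (t + k) *: p').
Proof.
move=> l0 g1.
pose I q := exists u v : {poly int}, q = u * g + l *: v.
have [h hm [u [v hE]]] : exists2 h, h \is monic & I h.
  apply: (monic_in_poly_ideal (absz l)).
  - split; first by exists 0, 0; rewrite mul0r scaler0 addr0.
    + move=> _ _ [u [v ->]] [u' [v' ->]]; exists (u - u'), (v - v').
      by rewrite -!mul_polyC; ring.
    + move=> p _ [u [v ->]]; exists (p * u), (p * v).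
      by rewrite -!mul_polyC; ring.
  - by rewrite absz_gt0 gt_eqF.
  - by exists 0, 1; rewrite mul0r add0r gtz0_abs // alg_polyC.
  - move=> p pp; exists g; first by exists 1, 0; rewrite mul1r scaler0 addr0.
    move=> pg; have : (p%:Z %| zcontents g)%Z.
      by rewrite dvdz_contents; apply/polyOverP.
    by rewrite g1 dvdzE /= dvdn1 => /eqP p1; move: pp; rewrite p1.
pose t := size h; exists t.
have step p : exists p', N (l ^+ t *: p - l ^+ t.+1 *: p').
  (* With h = u g + l v one has p = q u g + l q v + r. The first term is related, l^t clears r, and
     l q v is left over. *)
  pose q := Pdiv.Ring.rdivp p h; pose r := Pdiv.Ring.rmodp p h.
  exists (q * v).
  have -> : l ^+ t *: p - l ^+ t.+1 *: (q * v) = l ^+ t *: r + l ^+ t *: (q * u * g).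
    rewrite {1}(Pdiv.RingMonic.rdivp_eq hm p) -/q -/r {1}hE exprSr -!mul_polyC polyCM.
    by ring.
  apply: dilation_relatedD.
    apply: dilation_related_scaled; apply: ltnW.
    by apply: Pdiv.Ring.ltn_rmodpN0; apply: monic_neq0.
  apply/dilation_relatedZ/dilation_related_Qdvd.
  by rewrite mulrA; apply/QdvdMl/Qdvd_refl.
elim=> [|k IH] p; first by exists p; rewrite addn0 subrr; apply: dilation_related_Qdvd;
  rewrite mulr0; apply: Qdvd0.
have [p1 H1] := IH p; have [p2 H2] := step p1; exists p2.
have -> : l ^+ t *: p - l ^+ (t + k.+1) *: p2 =
  (l ^+ t *: p - l ^+ (t + k) *: p1) + l ^+ k *: (l ^+ t *: p1 - l ^+ t.+1 *: p2).
  by rewrite scalerBr !scalerA -!exprD ![(k + _)%N]addnC addSnnS addrA subrK.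
by apply: dilation_relatedD => //; apply: dilation_relatedZ.
Qed.
End DilationRelated.

(** In a finite image the powers of l act periodically from some exponent i on. Modulo A the element
    l^t p is l^i p' for some p', and l^i p' has the same image as l^n p' with n large, which lies in
    A. So l^t p outside A could not be separated. *)
Lemma bounded_of_separable (K : rng) (a : K) (g : {poly int}) :
  0 < lead_coef g -> zcontents g = 1 ->
  (forall q, ev a q = 0 -> Qdvd g ('X * q)) ->
  finitely_separable K ->
  exists t, forall p, dilation_related g (lead_coef g ^+ t *: p).
Proof.
set l := lead_coef g => l0 g1 kerg fs.
have [t Ht] := dilation_related_step g l0 g1; exists t => p.
set N := dilation_related g in Ht *.
apply: contrapT => nN.
have evB x y : ev a (x - y) = ev a x - ev a y by exact: lincombB.
have evZ k q : ev a (k *: q) = ev a q *~ k by exact: lincombZ.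
pose A y := exists2 q, y = ev a q & N q.
have AE q : A (ev a q) -> N q.
  case=> q' E Nq'; rewrite -[q](subrK q'); apply: dilation_relatedD => //.
  by apply/dilation_related_Qdvd/kerg; rewrite evB E subrr.
have As : subrng A.
  split; [|split].
  - exists 0; first by rewrite /ev lincomb0.
    by apply: dilation_related_Qdvd; rewrite mulr0; apply: Qdvd0.
  - move=> _ _ [x -> Nx] [y -> Ny]; exists (x - y); first by rewrite evB.
    exact: dilation_relatedB.
  - move=> _ _ [x -> Nx] [y -> Ny]; exists ('X * x * y); first by rewrite evM.
    exact: dilation_relatedM.
have nA : ~ A (ev a (l ^+ t *: p)) by move/AE.
have [F [phi [Ff [hom]]]] := fs _ A As nA; apply.
have [e e0 Fe] := finite_rng_exponent F Ff.
pose u n : 'I_e.-1.+1 := inord (absz (l ^+ n %% e%:Z)%Z).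
have [i [j [ti ij uij]]] := seq_repeats 'I_e.-1.+1 u t.
have e0' : e%:Z != 0 by lia.
have phil x n m : u n = u m -> phi (ev a (l ^+ n *: x)) = phi (ev a (l ^+ m *: x)).
  move=> /(congr1 val); rewrite /= !inordK; last 2 first.
  - by have := ltz_mod (l ^+ n) e0'; have := modz_ge0 (l ^+ n) e0'; lia.
  - by have := ltz_mod (l ^+ m) e0'; have := modz_ge0 (l ^+ m) e0'; lia.
  move=> E; rewrite !evZ !(rng_homMz hom).
  have {}E : (l ^+ n %% e%:Z)%Z = (l ^+ m %% e%:Z)%Z.
    by have := modz_ge0 (l ^+ n) e0'; have := modz_ge0 (l ^+ m) e0'; lia.
  rewrite (divz_eq (l ^+ n) e%:Z) (divz_eq (l ^+ m) e%:Z) E !mulrzDr.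
  by rewrite ![_ * e%:Z]mulrC !mulrzA !Fe !mul0rz.
have phij x m : phi (ev a (l ^+ i *: x)) = phi (ev a (l ^+ (i + m * (j - i)) *: x)).
  elim: m x => [|m IH] x; first by rewrite mul0n addn0.
  have -> : (i + m.+1 * (j - i) = j + m * (j - i))%N by lia.
  rewrite exprD -scalerA -(phil _ i j) // scalerA -exprD; exact: IH.
have [p' Np'] := Ht (i - t)%N p; rewrite subnKC // in Np'.
(* A whole number of periods beyond i, and at least [size p'], so that l^n p' is related. *)
pose n := (i + size p' * (j - i))%N.
have nN' : N (l ^+ n *: p') by apply: dilation_related_scaled; rewrite (leq_trans _ (leq_addl _ _)) // leq_pmulr // subn_gt0.
exists (ev a ((l ^+ t *: p - l ^+ i *: p') + l ^+ n *: p')); split.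
  by eexists; first reflexivity; apply: dilation_relatedD.
rewrite /ev lincombD -!/(ev _ _) evB; case: hom (hom) => HD _ hom.
by rewrite HD (rng_homB hom) -phij subrK.
Qed.

(** With L = l^t, each L X^(k+1) has an integer remainder modulo g of degree below deg g. Two of
    these remainders agree modulo L, and dividing their difference by L leaves a monic multiple of
    g. *)
Lemma monic_multiple_of_separable (K : rng) (a : K) (g : {poly int}) :
  0 < lead_coef g -> zcontents g = 1 ->
  (forall q, ev a q = 0 -> Qdvd g ('X * q)) ->
  finitely_separable K -> exists2 h, h \is monic & Qdvd g h.
Proof.
move=> l0 g1 kerg fs.
have [t Ht] := bounded_of_separable K a g l0 g1 kerg fs.
have g0 : g != 0 by rewrite -lead_coef_eq0 gt_eqF.
have [sg|sg] := leqP (size g) 1.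
  exists 1; first exact: monic1.
  have gC := size1_polyC sg; have c0 : g`_0 != 0 by rewrite -polyC_eq0 -gC.
  apply/(QdvdZ g g`_0) => //; rewrite alg_polyC -gC; exact: Qdvd_refl.
set l := lead_coef g in l0 Ht; pose n := (size g).-1.
have exrho k : exists r : {poly int}, (size r <= n)%N /\
    Qdvd g (l ^+ t *: 'X^(k.+1) - r).
  have [q Hq] := Ht 'X^k; have [s ss Hs] := reduce_dilated g q sg.
  exists s; split=> //; rewrite -[_ *: _](subrK (q \Po (lead_coef g *: 'X))) -addrA.
  by apply: QdvdD => //; move: Hq; rewrite -scalerAr -exprS.
have [rho rhoP] := choice exrho.
pose L := absz (l ^+ t).
have LE : l ^+ t = L%:Z by rewrite gtz0_abs // exprn_gt0.
have L0 : L%:Z != 0 by rewrite -LE expf_neq0 // gt_eqF.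
pose u k := [ffun i : 'I_n => inord (absz ((rho k)`_i %% L%:Z)%Z) : 'I_L.-1.+1].
(* Indices start at n so that X^(j+1) dominates X^(i+1) and also s, of size at most n. *)
have [i [j [ni ij uij]]] := seq_repeats _ u n.
have /poly_dvdz_coef [s sE] : forall k, (L%:Z %| (rho j - rho i)`_k)%Z.
  move=> k; rewrite coefB; have [kn|kn] := ltnP k n; last first.
    have [[si _] [sj _]] := (rhoP i, rhoP j).
    by rewrite !nth_default ?subrr ?dvdz0 // (leq_trans _ kn).
  have := congr1 (fun f : {ffun 'I_n -> 'I_L.-1.+1} => val (f (Ordinal kn))) uij.
  rewrite !ffunE /= !inordK; last 2 first.
  - by have := ltz_mod (rho i)`_k L0; have := modz_ge0 (rho i)`_k L0; lia.
  - by have := ltz_mod (rho j)`_k L0; have := modz_ge0 (rho j)`_k L0; lia.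
  move=> E; rewrite -eqz_mod_dvd; apply/eqP.
  by have := modz_ge0 (rho i)`_k L0; have := modz_ge0 (rho j)`_k L0; lia.
have ss : (size s <= n)%N.
  rewrite -(size_scale s L0) -sE (leq_trans (size_polyD _ _)) // size_polyN geq_max.
  by rewrite (rhoP i).1 (rhoP j).1.
exists ('X^(j.+1) - ('X^(i.+1) + s)).
  have sm : (size ('X^(i.+1) + s)%R < size ('X^(j.+1) : {poly int})%R)%N.
    rewrite size_polyXn ltnS (leq_trans (size_polyD _ _)) // geq_max size_polyXn.
    by rewrite ltnS ij (leq_trans ss) // (leq_trans ni) // ltnW // ltnW.
  by rewrite monicE lead_coefDl ?size_polyN // lead_coefXn.
apply/(QdvdZ g L%:Z) => //.
have -> : L%:Z *: ('X^(j.+1) - ('X^(i.+1) + s)) =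
  (L%:Z *: 'X^(j.+1) - rho j) - (L%:Z *: 'X^(i.+1) - rho i).
  by rewrite !scalerBr scalerDr -sE; ring.
by rewrite -LE; apply: QdvdB; [case: (rhoP j)|case: (rhoP i)].
Qed.

(** * The presentation by f *)

Lemma prime_dvd_prod (p : nat) (s : seq nat) :
  prime p -> all prime s -> (p %| \prod_(q <- s) q)%N -> p \in s.
Proof.
move=> pp; elim: s => [|q s IH] /=; first by rewrite big_nil dvdn1 => _ /eqP p1; rewrite p1 in pp.
move=> /andP[pq ps]; rewrite big_cons Euclid_dvdM // inE => /orP[|/IH->//].
  by rewrite dvdn_prime2 // => ->.
by rewrite orbT.
Qed.

Lemma squarefreeP (n : nat) : (0 < n)%N ->
  squarefree n <-> (forall p, prime p -> ~ (p * p %| n)%N).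
Proof.
move=> n0; split=> [[s [us ps nE]] p pp|sq].
  have p0 := prime_gt0 pp; rewrite nE => pps.
  have sp : p \in s by apply: prime_dvd_prod => //; apply: dvdn_trans pps; apply: dvdn_mulr.
  move: pps; rewrite (big_rem p sp) dvdn_pmul2l // => /(prime_dvd_prod _ _ pp).
  have -> : all prime (rem p s) by apply/allP => q /mem_rem/(allP ps).
  by move/(_ isT); rewrite mem_rem_uniq // inE eqxx.
exists (primes n); split; first exact: primes_uniq.
  by apply/allP => p; rewrite mem_primes => /andP[].
rewrite {1}(prod_prime_decomp n0) prime_decompE big_map; apply: eq_big_seq => p /= pn.
have pp : prime p by move: pn; rewrite mem_primes => /andP[].
have l0 : (0 < logn p n)%N by rewrite logn_gt0.
have : ~~ (1 < logn p n)%N.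
  by apply/negP; rewrite -pfactor_dvdn // -mulnn; apply: sq.
by rewrite -leqNgt => l1; have -> : logn p n = 1%N by lia.
Qed.

Lemma dvd_coef_gcd (m : nat) (f : 'I_m -> {poly int}) (d : nat) :
  (d %| coef_gcd f)%N <-> (forall j i, (d%:Z %| (f j)`_i)%Z).
Proof.
split=> [/dvdn_biggcdP df j i|df].
  have [isz|isz] := ltnP i (size (f j)); last by rewrite nth_default // dvdz0.
  have /dvdn_biggcdP dfj := df j isT.
  by rewrite dvdzE; apply: (dfj (Ordinal isz)).
apply/dvdn_biggcdP => j _; apply/dvdn_biggcdP => i _.
by have := df j i; rewrite dvdzE.
Qed.

Section InIdeal.
Context {m : nat} (f : 'I_m -> {poly int}).
Let toQ : {poly int} -> {poly rat} := map_poly intr.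

Lemma in_ideal_gen j p : in_ideal f (p * f j).
Proof.
exists (fun i => if i == j then p else 0).
rewrite (bigD1 j) //= eqxx big1 ?addr0 // => i /negPf ->.
by rewrite mul0r.
Qed.

Lemma in_idealD p q : in_ideal f p -> in_ideal f q -> in_ideal f (p + q).
Proof.
move=> [u ->] [v ->]; exists (fun j => u j + v j).
by rewrite -big_split; apply: eq_bigr => j _; rewrite mulrDl.
Qed.

Lemma in_idealM p q : in_ideal f q -> in_ideal f (p * q).
Proof.
move=> [u ->]; exists (fun j => p * u j).
by rewrite mulr_sumr; apply: eq_bigr => j _; rewrite mulrA.
Qed.

Lemma in_ideal_coef_gcd (d : nat) p :
  (d %| coef_gcd f)%N -> in_ideal f p -> forall i, (d%:Z %| p`_i)%Z.
Proof.
move=> /dvd_coef_gcd df [u ->] i; rewrite coef_sum rpred_sum // => j _.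
by rewrite coefM rpred_sum // => k _; apply: dvdz_mull.
Qed.

Definition Q_gcd : {poly rat} := \big[@gcdp rat/0]_(j < m) toQ (f j).

Lemma Q_gcd_dvd j : Q_gcd %| toQ (f j).
Proof.
rewrite /Q_gcd; have : j \in index_enum 'I_m by rewrite mem_index_enum.
elim: (index_enum _) => [|i s IH] //; rewrite big_cons inE => /orP[/eqP->|/IH].
  exact: dvdp_gcdl.
exact: dvdp_trans (dvdp_gcdr _ _).
Qed.

Lemma in_ideal_Q_gcd p : in_ideal f p -> Q_gcd %| toQ p.
Proof.
move=> [u ->]; rewrite /toQ rmorph_sum /=; apply: (big_ind (fun x => Q_gcd %| x)).
- exact: dvdp0.
- by move=> x y; apply: dvdp_add.
- by move=> j _; rewrite rmorphM dvdp_mull // Q_gcd_dvd.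
Qed.

(** Bezout with denominators cleared: the polynomials having a nonzero integer multiple in the ideal
    form an ideal of Q[X], which is closed under gcd. *)
Lemma Q_gcd_bezout : exists2 k : int, k != 0 &
  exists2 z, in_ideal f z & toQ z = k%:~R *: Q_gcd.
Proof.
pose B (P : {poly rat}) := exists2 k : int, k != 0 &
  exists2 z, in_ideal f z & toQ z = k%:~R *: P.
have toQM x y : toQ (x * y) = toQ x * toQ y by exact: rmorphM.
have toQD x y : toQ (x + y) = toQ x + toQ y by exact: rmorphD.
have BM u P : B P -> B (u * P).
  case=> k k0 [z Iz zE]; have [v [c c0 uE]] := rat_poly_scale u.
  have c0' : c%:~R != 0 :> rat by rewrite intr_eq0.
  exists (c * k); first exact: mulf_neq0.
  exists (v * z); first exact: in_idealM.
  rewrite uE toQM zE -scalerAl -scalerAr scalerA rmorphM /=.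
  by rewrite mulrAC divff // mul1r.
have BD P Q : B P -> B Q -> B (P + Q).
  move=> [k k0 [z Iz zE]] [l l0 [y Iy yE]]; exists (k * l); first exact: mulf_neq0.
  exists (l%:P * z + k%:P * y); first by apply: in_idealD; apply: in_idealM.
  rewrite toQD !toQM zE yE /toQ !map_polyC !mul_polyC !scalerA.
  by rewrite scalerDr rmorphM /= [l%:~R * _]mulrC.
rewrite -/(B Q_gcd); apply: (big_ind B).
- exists 1 => //; exists 0; last by rewrite /toQ rmorph0 scaler0.
  by exists (fun=> 0); rewrite big1 // => j _; rewrite mul0r.
- move=> P Q BP BQ; have [[u v] /= /eqpf_eq [c c0 E]] := Bezoutp P Q.
  rewrite -[gcdp P Q](scalerK c0) -E -mul_polyC.
  by apply/BM/BD; apply: BM.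
- move=> j _; exists 1 => //; exists (f j); last by rewrite scale1r.
  by rewrite -[f j]mul1r; apply: in_ideal_gen.
Qed.

Lemma Q_gcd_neq0 : (exists j, f j != 0) -> Q_gcd != 0.
Proof.
case=> j; apply: contraNneq => g0; have := Q_gcd_dvd j.
rewrite g0 dvd0p => /eqP E; apply/eqP.
by apply: (map_inj_poly (intr_inj (R := rat))); rewrite // /toQ in E *; rewrite E rmorph0.
Qed.
End InIdeal.

(** By Gauss, h = p r over Z with G = a p. The leading coefficients of p and r have product 1 and G
    is monic, so a is the leading coefficient of r. *)
Lemma int_coefs_of_monic_multiple (G : {poly rat}) (h : {poly int}) :
  G \is monic -> h \is monic -> G %| map_poly intr h -> int_coefs G.
Proof.
move=> Gm hm /dvdpP_rat_int [p [a a0 GE] [r hE]] i.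
have := congr1 lead_coef hE; rewrite lead_coefM (monicP hm) => lpr.
have lp0 : lead_coef p != 0 by apply/eqP => l0; move: lpr; rewrite l0 mul0r => /eqP.
have := monicP Gm; rewrite GE lead_coefZ lead_coef_map_inj //; last exact: intr_inj.
move=> al; have aE : a = (lead_coef r)%:~R.
  apply: (mulIf (x := (lead_coef p)%:~R)); first by rewrite intr_eq0.
  by rewrite al -intrM mulrC -lpr.
by exists (lead_coef r * p`_i); rewrite coefZ coef_map aE intrM.
Qed.

Section Presentation.
Context {m : nat} {f : 'I_m -> {poly int}} {K : rng} {a : K}.
Context (fN : exists j, f j != 0).
Context (surj : forall y, exists q, y = ev a q).
Context (kerE : forall q, ev a q = 0 <-> in_ideal f ('X * q)).
Let toQ : {poly int} -> {poly rat} := map_poly intr.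

Lemma coef_gcd_gt0 : (0 < coef_gcd f)%N.
Proof.
rewrite lt0n; apply/eqP => c0; have [j /eqP] := fN; apply; apply/polyP => i.
have /dvd_coef_gcd/(_ j i) : (0 %| coef_gcd f)%N by rewrite c0.
by rewrite coef0 dvd0z => /eqP.
Qed.

Lemma ker_coef_gcd (d : nat) q :
  (d %| coef_gcd f)%N -> ev a q = 0 -> forall i, (d%:Z %| q`_i)%Z.
Proof.
move=> dc /kerE Iq i; have := in_ideal_coef_gcd f d _ dc Iq i.+1.
by rewrite coefXM.
Qed.

Lemma monic_gcd_monic : monic_gcd f \is monic.
Proof.
rewrite monicE lead_coefZ mulVf // lead_coef_eq0; exact: Q_gcd_neq0.
Qed.

Lemma necessity : finitely_separable K ->
  squarefree (coef_gcd f) /\ int_coefs (monic_gcd f).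
Proof.
move=> fs; split.
  apply/(squarefreeP _ coef_gcd_gt0) => p pp ppc.
  apply: (not_separable_of_square K a p (prime_gt1 pp)) fs => q q0.
  exact: ker_coef_gcd.
have G0 := Q_gcd_neq0 f fN.
have [q [k k0 qE]] := rat_poly_scale (Q_gcd f).
have kQ0 : (k%:~R : rat)^-1 != 0 by rewrite invr_eq0 intr_eq0.
have q0 : q != 0.
  by apply: contraNneq G0 => q0; rewrite qE q0 rmorph0 scaler0.
(* A primitive integer polynomial proportional to the rational gcd, with positive leading
   coefficient. *)
pose g := zprimitive q.
have gG : toQ g %= Q_gcd f.
  rewrite qE {1}(zpolyEprim q) map_polyZ scalerA eqp_sym; apply: eqp_scale.
  by rewrite mulf_neq0 // intr_eq0 zcontents_eq0.
have [h hm gh] : exists2 h, h \is monic & Qdvd g h.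
  apply: (monic_multiple_of_separable K a) => //.
  - by rewrite -sgz_gt0 sgz_lead_primitive q0.
  - by rewrite zcontents_primitive q0.
  - by move=> p /kerE Ip; rewrite /Qdvd (eqp_dvdl _ gG); apply: in_ideal_Q_gcd.
apply: (int_coefs_of_monic_multiple _ h) => //; first exact: monic_gcd_monic.
rewrite dvdpZl ?invr_eq0 ?lead_coef_eq0 // -/(toQ _) -/(Q_gcd f).
by rewrite -(eqp_dvdl _ gG).
Qed.

(** Each f_j is c g q_j with g monic over Z. The ideal I of those q for which c g q vanishes at [a]
    contains a positive integer by Bezout, and no prime divides all of I since c is the full gcd of
    the coefficients. So I contains a monic h, and w = g h. *)
Lemma monic_annihilator : int_coefs (monic_gcd f) ->
  exists2 w, w \is monic & ev a ((coef_gcd f)%:Z *: w) = 0.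
Proof.
move=> /choice [z zE]; set c := coef_gcd f; have c0 := coef_gcd_gt0.
pose g := \poly_(i < size (monic_gcd f)) z i.
have gE : toQ g = monic_gcd f.
  apply/polyP => i; rewrite coef_map coef_poly; case: ltnP => h; first by rewrite zE.
  by rewrite nth_default.
have gm : g \is monic.
  have := monic_gcd_monic; rewrite -gE !monicE lead_coef_map_inj; [|exact: intr_inj|by []].
  by rewrite -[_ == 1 :> int](eqr_int rat).
have G0 := Q_gcd_neq0 f fN.
have lG0 : (lead_coef (Q_gcd f))^-1 != 0 by rewrite invr_eq0 lead_coef_eq0.
have fE j : exists q, f j = c%:Z *: (g * q).
  have /poly_dvdz_coef [f' f'E] : forall i, (c%:Z %| (f j)`_i)%Z.
    by move=> i; have [dvd_c _] := dvd_coef_gcd m f c; apply: dvd_c.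
  (* Divisibility holds over Q, and passes to Z because the monic g is primitive. *)
  have : g %| f'.
    rewrite -dvdp_rat_int -/(toQ g) gE /monic_gcd dvdpZl // -/(Q_gcd f).
    have := Q_gcd_dvd f j; rewrite f'E map_polyZ dvdpZr // intr_eq0.
    by rewrite -lt0n.
  by move=> /dvdpP_int [r rE]; exists r; rewrite f'E {1}rE zprimitive_monic.
pose I q := ev a (c%:Z *: (g * q)) = 0.
have PI : poly_ideal I.
  split; rewrite /I.
  - by rewrite mulr0 scaler0 /ev lincomb0.
  - by move=> p q Ip Iq; rewrite mulrBr scalerBr /ev lincombB -!/(ev _ _) Ip Iq subrr.
  - move=> p q Iq; have -> : c%:Z *: (g * (p * q)) = c%:Z *: (g * q) * p.
      by rewrite -!mul_polyC; ring.
    exact: ev_ideal.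
have [n n0 In] : exists2 n : nat, (0 < n)%N & I n%:Z%:P.
  have [k k0 [y Iy]] := Q_gcd_bezout f; rewrite -/(toQ y) => yE.
  pose l := lead_coef (Q_gcd f).
  have [v [e e0 lE]] := rat_poly_scale (l^-1)%:P.
  have yg : exists2 k' : int, k' != 0 & in_ideal f (k'%:P * g).
    exists (e * k); first exact: mulf_neq0.
    have -> : (e * k)%:P * g = v * y.
      apply: (map_inj_poly (intr_inj (R := rat))) => //.
      have toQM x1 x2 : toQ (x1 * x2) = toQ x1 * toQ x2 by exact: rmorphM.
      rewrite -!/(toQ _) !toQM gE yE.
      have vE : toQ v = e%:~R *: (l^-1)%:P.
        by rewrite lE scalerA divff ?intr_eq0 // scale1r.
      by rewrite vE /toQ !map_polyC /= /monic_gcd -/(Q_gcd f) -/l -!mul_polyC; ring.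
    exact: in_idealM.
  have [k' k'0 Ik'] := yg; exists (absz k'); first by rewrite absz_gt0.
  apply/kerE; have -> : 'X * (c%:Z *: (g * (absz k')%:Z%:P)) =
     (c%:Z *: ('X * (sgz k')%:P)) * (k'%:P * g).
    by rewrite abszEsg polyCM -!mul_polyC; ring.
  exact: in_idealM.
have cI p : prime p -> exists2 q, I q & ~ (forall i, (p%:Z %| q`_i)%Z).
  move=> pp; apply: contrapT => nex.
  have : (p * c %| c)%N.
    apply/dvd_coef_gcd => j i; have [q qE] := fE j.
    have /poly_dvdz_coef [q' q'E] : forall i, (p%:Z %| q`_i)%Z.
      apply: contrapT => nq; apply: nex; exists q => //.
      by apply/kerE; rewrite -qE; apply: in_ideal_gen.
    have -> : f j = (p * c)%N%:Z *: (g * q').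
      by rewrite qE q'E PoszM -!mul_polyC polyCM; ring.
    by rewrite coefZ; apply: dvdz_mulr; apply: dvdzz.
  by move/dvdn_leq => /(_ c0); have := prime_gt1 pp; nia.
have [h hm Ih] := monic_in_poly_ideal n I PI n0 In cI.
by exists (g * h) => //; rewrite monicMl.
Qed.

Lemma sufficiency : squarefree (coef_gcd f) -> int_coefs (monic_gcd f) ->
  finitely_separable K.
Proof.
move=> /(squarefreeP _ coef_gcd_gt0) sqf /monic_annihilator [w wm w0].
apply: (separable_of_monic K a (coef_gcd f) w) => //; last exact: coef_gcd_gt0.
by move=> q; apply: ker_coef_gcd.
Qed.
End Presentation.

Theorem theorem1 (m : nat) (f : 'I_m -> {poly int}) (K : rng) (a : K) :
  (forall j, (f j)`_0 = 0) ->
  (exists j, f j != 0) ->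
  (* K = Z<a> is generated by a: every element is p(a), p in xZ[x] *)
  (forall y : K, exists p : {poly int}, p`_0 = 0 /\ y = reval p a) ->
  (* the relations of a are exactly the ideal V = (f_1, ..., f_m) *)
  (forall p : {poly int}, p`_0 = 0 -> (reval p a = 0 <-> in_ideal f p)) ->
  finitely_separable K <-> (squarefree (coef_gcd f) /\ int_coefs (monic_gcd f)).
Proof.
move=> _ fN gen rel.
have surj y : exists q, y = ev a q.
  have [p [p0 ->]] := gen y; elim/poly_ind: p p0 => [|q c _].
    by exists 0; rewrite -reval_mulX mulr0.
  rewrite coefD coefMX coefC add0r /= => ->; exists q.
  by rewrite addr0 mulrC reval_mulX.
have kerE q : ev a q = 0 <-> in_ideal f ('X * q).
  by rewrite -reval_mulX; apply: rel; rewrite coefXM.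
by split=> [|[]]; [apply: necessity|apply: sufficiency].
Qed.
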